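(* Let $X$ be a Banach space and $\bar e=(e_j)_{j\in\mathbb N}$ an asymptotic model generated by a normalized weakly null array in $X$. Then for every $k\in\mathbb N$ and $\varepsilon>0$ the metric space $([\mathbb N]^k,d^{(k)}_{\bar e})$ bi-Lipschitzly embeds into $X$ with distortion at most $2+\varepsilon$.
   Context: A normalized weakly null array is a family $(x^{(i)}_j:i,j\in\mathbb N)$ of unit vectors with each row $(x^{(i)}_j)_j$ weakly null. A basic sequence $(e_i)$ is an asymptotic model generated by it if there is a null sequence $(\varepsilon_n)$ in $(0,1)$ with $\big|\|\sum_{i=1}^na_ix^{(i)}_{k_i}\|-\|\sum_{i=1}^na_ie_i\|\big|<\varepsilon_n$ for all $n$, $(a_i)\subset[-1,1]$, $n\le k_1<\dots<k_n$. Such $\bar e$ is normalized and $1$-suppression unconditional. For $\bar m=\{m_1<\dots<m_k\},\bar n=\{n_1<\dots<n_k\}\in[\mathbb N]^k$, $d^{(k)}_{\bar e}(\bar m,\bar n)=\|\sum_{j\in F}e_j\|$ with $F=\{j:m_j\ne n_j\}$. A metric space $M$ bi-Lipschitzly embeds into $X$ with distortion at most $D$ if there are $s>0$ and $f:M\to X$ with $s\,d(x,y)\le\|f(x)-f(y)\|\le sD\,d(x,y)$. *)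

(* Defs.v *)
From HB Require Import structures.
From mathcomp Require Import all_boot all_order all_algebra.
From mathcomp Require Import all_classical all_reals all_analysis.
Set Implicit Arguments. Unset Strict Implicit. Unset Printing Implicit Defensive.
Import Order.TTheory GRing.Theory Num.Theory.
Import numFieldNormedType.Exports.
Local Open Scope classical_set_scope.
Local Open Scope ring_scope.

Definition bounded_functional (R : realType) (X : normedModType R) (f : X -> R) :=
  (forall (a : R) (u v : X), f (a *: u + v) = a * f u + f v) /\ continuous f.

Definition weakly_null (R : realType) (X : normedModType R) (y : nat -> X) :=
  forall f : X -> R, bounded_functional f -> (f \o y) @ \oo --> (0 : R).

Definition normalized_weakly_null_array (R : realType) (X : normedModType R)
  (x : nat -> nat -> X) :=
  (forall i j, `|x i j| = 1) /\ (forall i, weakly_null (x i)).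

(* Basic sequence (Grunblum criterion: nonzero vectors and a uniform bound on
   the partial-sum projections). *)
Definition basic_sequence (R : realType) (E : normedModType R) (e : nat -> E) :=
  (forall i, e i != 0) /\
  exists K : R, forall (a : nat -> R) (m n : nat), (m <= n)%N ->
    `|\sum_(i < m) a i *: e i| <= K * `|\sum_(i < n) a i *: e i|.

Definition asymptotic_model (R : realType) (X E : normedModType R)
  (x : nat -> nat -> X) (e : nat -> E) :=
  basic_sequence e /\
  exists eps : nat -> R,
    (forall n, 0 < eps n < 1) /\ eps @ \oo --> (0 : R) /\
    forall (n : nat) (a : nat -> R) (k : nat -> nat),
      (forall i, (i < n)%N -> -1 <= a i <= 1) ->
      (n <= k 0%N)%N ->
      (forall i, (i.+1 < n)%N -> (k i < k i.+1)%N) ->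
      `| `|\sum_(i < n) a i *: x i (k i)| - `|\sum_(i < n) a i *: e i| |
        < eps n.

Definition kset (k : nat) := {t : k.-tuple nat | sorted ltn t}.

Definition dk (R : realType) (E : normedModType R) (e : nat -> E) (k : nat)
  (m n : kset k) : R :=
  `| \sum_(j < k | tnth (val m) j != tnth (val n) j) e j |.

Definition bilip_embeds (R : realType) (M : Type) (d : M -> M -> R)
  (X : normedModType R) (D : R) :=
  exists s : R, 0 < s /\ exists f : M -> X,
    forall y z : M, s * d y z <= `|f y - f z| <= s * D * d y z.

(* Main.v *)
(* Let L(v, a_1 ... a_p) be the iterated limit, first in j_p and lastly in j_1,
   of |v + y_{a_1}(j_1) + ... + y_{a_p}(j_p)| along a free ultrafilter. As a
   function of v it is convex and 1-Lipschitz, so it has a continuous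
   subgradient (Hahn-Banach), and weak nullness of the y_a gives
   L(v, w) <= L(v, a w): erasing letters does not increase L. Along suitable
   columns c_0 < c_1 < ... norms are uniformly close to the iterated limits, so
   sums of bounded length in distinct columns are suppression unconditional up
   to a small additive error. The embedding is
   f(m) = sum_i x^(i)_{c(k m_i + i)}: distinct rows never share a column, so
   erasing the n-part of f(m) - f(n) leaves a sum of norm about d(m, n); the
   upper bound is the triangle inequality, whence the factor 2. *)
Require Import Defs.
From HB Require Import structures.
From mathcomp Require Import all_boot all_order all_algebra.
From mathcomp Require Import all_classical all_reals all_analysis.
From mathcomp Require Import ring lra.
Set Implicit Arguments.
Unset Strict Implicit.
Unset Printing Implicit Defensive.
Import Order.TTheory GRing.Theory Num.Theory.
Import numFieldNormedType.Exports.
Local Open Scope classical_set_scope.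
Local Open Scope ring_scope.

(** * Convex functions: infima of families and slopes along lines *)

Definition convex_on_lmod (R : realType) (X : lmodType R) (q : X -> R) :=
  forall (t : R) (u v : X), 0 <= t <= 1 ->
    q (t *: u + (1 - t) *: v) <= t * q u + (1 - t) * q v.

Lemma inf_range_le (R : realType) (I : Type) (F : I -> R) (b : R) (i : I) :
  (forall i, b <= F i) -> inf (range F) <= F i.
Proof.
move=> bF; apply: ge_inf; last by exists i.
by exists b => _ [j _ <-].
Qed.

Lemma inf_range_ge (R : realType) (I : Type) (F : I -> R) (b : R) (i : I) :
  (forall i, b <= F i) -> b <= inf (range F).
Proof.
move=> bF; apply: lb_le_inf; first by exists (F i), i.
by move=> _ [j _ <-].
Qed.

Lemma inf_range_adherent (R : realType) (I : Type) (F : I -> R) (b : R) (i : I)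
    (d : R) :
  (forall i, b <= F i) -> 0 < d -> exists j, F j < inf (range F) + d.
Proof.
move=> bF d0; have [|_ [j _ <-] Fj] := @inf_adherent _ (range F) d d0.
  by split; [exists (F i), i | exists b => _ [j _ <-]].
by exists j.
Qed.

(** Near-minimisers at [u] and [v] are merged into one index [k] that may depend on all the data.
    This form serves both the infimum over a chain and the infimum over translates along a line. *)
Lemma convex_inf (R : realType) (X : lmodType R) (I : Type) (F : I -> X -> R)
    (b : X -> R) (i0 : I) :
  (forall i h, b h <= F i h) ->
  (forall i j (t : R) (u v : X), 0 <= t <= 1 -> exists k,
     F k (t *: u + (1 - t) *: v) <= t * F i u + (1 - t) * F j v) ->
  convex_on_lmod (fun h => inf (range (F^~ h))).
Proof.
move=> bF conv t u v t01; apply/ler_addgt0Pr => d d0.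
have [i Fi] := inf_range_adherent i0 (bF^~ u) d0.
have [j Fj] := inf_range_adherent i0 (bF^~ v) d0.
have [k Fk] := conv i j t u v t01.
apply: (le_trans (inf_range_le k (bF^~ _))); apply: (le_trans Fk).
case/andP: t01 => t0 t1.
have := ler_wpM2l t0 (ltW Fi).
have t1' : 0 <= 1 - t by rewrite subr_ge0.
have := ler_wpM2l t1' (ltW Fj).
lra.
Qed.

(** Convexity at the midpoint [0] of [h] and [- h]. It turns upper bounds on convex functions into
    lower bounds. *)
Lemma convex_ge_opp (R : realType) (X : lmodType R) (q : X -> R) (h : X) :
  convex_on_lmod q -> 2 * q 0 - q (- h) <= q h.
Proof.
move=> cq; have h01 : 0 <= (2^-1 : R) <= 1 by lra.
have := cq 2^-1 h (- h) h01.
have -> : 1 - 2^-1 = 2^-1 :> R by field.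
rewrite scalerN subrr; lra.
Qed.

Lemma convex_line_slope (R : realType) (X : lmodType R) (q : X -> R) (a : X) :
  convex_on_lmod q -> q 0 = 0 -> exists c, forall t, t * c <= q (t *: a).
Proof.
move=> cq q0.
(* Since [0] is the combination of [t *: a] and [- s *: a] with weights [s / (s + t)] and
   [t / (s + t)], left slopes lie below right slopes; the supremum of the left ones separates
   them. *)
have slopes (s t : R) : 0 < s -> 0 < t -> - q (- s *: a) / s <= q (t *: a) / t.
  move=> s0 t0; rewrite ler_pdivrMr// mulrAC ler_pdivlMr//.
  have st0 : 0 < s + t by rewrite addr_gt0.
  have st01 : 0 <= s / (s + t) <= 1.
    by rewrite (divr_ge0 (ltW s0) (ltW st0))/= ler_pdivrMr// mul1r lerDl ltW.
  have := cq _ (t *: a) (- s *: a) st01.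
  have -> : 1 - s / (s + t) = t / (s + t) by field; rewrite gt_eqF.
  rewrite !scalerA -scalerDl.
  have -> : s / (s + t) * t + t / (s + t) * - s = 0 by ring.
  rewrite scale0r q0 mulrAC (mulrAC t) -mulrDl pmulr_lge0 ?invr_gt0//.
  lra.
pose S := [set - q (- s *: a) / s | s in [set s : R | 0 < s]].
have S1 : S !=set0 by exists (- q (- 1 *: a) / 1), 1 => //=.
have ubS t : 0 < t -> ubound S (q (t *: a) / t).
  by move=> t0 _ [s /= s0 <-]; exact: slopes.
exists (sup S) => t; case: (ltgtP t 0) => [t0|t0|->].
- have nt0 : 0 < - t by rewrite oppr_gt0.
  have : - q (- (- t) *: a) / (- t) <= sup S.
    apply: ub_le_sup; first by exists (q (1 *: a) / 1); exact: ubS.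
    by exists (- t).
  rewrite ler_pdivrMr// opprK; lra.
- have := ge_sup S1 (ubS t t0).
  by rewrite ler_pdivlMr// mulrC.
- by rewrite mul0r scale0r q0.
Qed.

(** * Hahn-Banach through minimal convex minorants *)

Section convex_minorants.
Variables (R : realType) (X : lmodType R) (p : X -> R).

(** For convex [q], the condition at [0] forces [- p (- h) <= q h], so that pointwise infima of
    minorants stay finite. *)
Definition convex_minorant (q : X -> R) :=
  [/\ convex_on_lmod q, 0 <= q 0 & forall h, q h <= p h].

(** Zorn's lemma for the reversed pointwise order: a nonempty chain is bounded by its pointwise
    infimum, the empty one by [p]. *)
Lemma minimal_convex_minorant : convex_on_lmod p -> 0 <= p 0 ->
  exists2 q, convex_minorant q &
    forall r, convex_minorant r -> (forall h, r h <= q h) ->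
    forall h, q h <= r h.
Proof.
move=> cp p0; pose T := {q | convex_minorant q}.
pose le (q r : T) := `[< forall h, sval r h <= sval q h >].
have P0 : convex_minorant p by [].
have [| | |q qmax] := @ZL_preorder T (exist _ p P0) le.
- by move=> q; apply/asboolP.
- move=> q r s /asboolP qr /asboolP rs; apply/asboolP => h.
  exact: le_trans (rs h) (qr h).
- move=> A Atot; have [[q0 Aq0]|A0] := pselect (A !=set0); last first.
    by exists (exist _ p P0) => s As; case: A0; exists s.
  pose F (i : {q | A q}) := sval (sval i).
  pose i0 : {q | A q} := exist _ q0 Aq0.
  have Fb i h : - p (- h) <= F i h.
    have [ci i0' ip] := svalP (sval i).
    have := convex_ge_opp h ci; have := ip (- h); rewrite /F; lra.
  have convI : convex_minorant (fun h => inf (range (F^~ h))).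
    split.
    + apply: (convex_inf i0 Fb) => i j t u v t01.
      case/andP: (t01) => t0 t1.
      have t1' : 0 <= 1 - t by rewrite subr_ge0.
      have [/asboolP ij|/asboolP ji] := Atot _ _ (svalP i) (svalP j).
        exists j; have [cj _ _] := svalP (sval j).
        apply: (le_trans (cj _ _ _ t01)); rewrite lerD2r.
        exact: ler_wpM2l.
      exists i; have [ci _ _] := svalP (sval i).
      apply: (le_trans (ci _ _ _ t01)); rewrite lerD2l.
      exact: ler_wpM2l.
    + by apply: (inf_range_ge i0) => i; have [] := svalP (sval i).
    + move=> h; apply: (le_trans (inf_range_le i0 (Fb^~ h))).
      by have [_ _] := svalP q0; apply.
  exists (exist _ _ convI) => s As; apply/asboolP => h.
  exact: (inf_range_le (exist _ s As : {q | A q}) (Fb^~ h)).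
exists (sval q); first exact: svalP.
move=> r Pr rq h; have /asboolP := qmax (exist _ r Pr) (asboolT rq).
exact.
Qed.

(** A minimal convex minorant vanishes at [0] and is affine along every direction, hence is
    linear. *)
Lemma linear_minorant : convex_on_lmod p -> 0 <= p 0 ->
  exists2 f : X -> R, forall (a : R) u v, f (a *: u + v) = a * f u + f v &
    forall h, f h <= p h.
Proof.
move=> cp p0; have [q0 [cq0 q00 qp0] qmin0] := minimal_convex_minorant cp p0.
pose q h := q0 h - q0 0.
have cq : convex_on_lmod q.
  by move=> t u v t01; have := cq0 _ u v t01; rewrite /q; lra.
have q0E : q0 0 = 0.
  apply/eqP; rewrite eq_le q00 andbT.
  (* Lowering [q0] by the constant [q0 0] gives another convex minorant, so minimality forces
     [q0 0 <= 0]. *)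
  have : q0 0 <= q 0; last by rewrite /q subrr.
  apply: qmin0; last by move=> h; rewrite /q gerBl.
  split=> //; first by rewrite /q subrr.
  by move=> h; rewrite /q; have := qp0 h; lra.
(* If c is a slope of q0 along a, then h |-> inf_t q0 (h + t a) - t c is again a
   convex minorant, so minimality makes q0 affine along a. *)
have affine a : exists c, forall t h, q0 h <= q0 (h + t *: a) - t * c.
  have [c cP] := convex_line_slope a cq0 q0E.
  exists c => t h.
  pose F (t : R) h := q0 (h + t *: a) - t * c.
  (* The midpoint of [h' + t' *: a] and [- h'] lies on the line through [0], where the slope bound
     [cP] applies. *)
  have Fb t' h' : - q0 (- h') <= F t' h'.
    have h01 : 0 <= (2^-1 : R) <= 1 by lra.
    have := cq0 2^-1 (h' + t' *: a) (- h') h01.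
    have -> : 1 - 2^-1 = 2^-1 :> R by field.
    rewrite -scalerDr addrAC subrr add0r scalerA.
    have := cP (2^-1 * t'); rewrite /F; lra.
  have F0 h' : F 0 h' = q0 h' by rewrite /F scale0r addr0 mul0r subr0.
  apply: le_trans (inf_range_le t (Fb^~ h)).
  apply: (qmin0 (fun h => inf (range (F^~ h)))); last first.
    by move=> h'; rewrite -[leRHS]F0; exact: inf_range_le (Fb^~ h').
  split.
  - apply: (convex_inf 0 Fb) => i j s u v s01.
    exists (s * i + (1 - s) * j).
    have := cq0 _ (u + i *: a) (v + j *: a) s01.
    rewrite !scalerDr addrACA !scalerA -scalerDl /F; lra.
  - apply: (inf_range_ge 0) => t'; rewrite /F add0r subr_ge0; exact: cP.
  - move=> h'; apply: le_trans (inf_range_le 0 (Fb^~ h')) _.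
    by rewrite F0.
have eqn a : exists c, forall t h, q0 (h + t *: a) = q0 h + t * c.
  have [c cP] := affine a; exists c => t h; apply/eqP.
  (* The reverse inequality is the same bound taken at [h + t *: a] with parameter [- t]. *)
  rewrite eq_le; have := cP t h; have := cP (- t) (h + t *: a).
  rewrite scaleNr addrK; lra.
exists q0 => // a u v; have [c cE] := eqn u.
have := cE a v; have := cE 1 0; rewrite q0E scale1r !add0r mul1r => -> .
by rewrite addrC => ->; rewrite addrC.
Qed.
End convex_minorants.

(** A linear minorant of the increment [g (v + h) - g v] is at most [|h|] by the Lipschitz bound,
    hence continuous. *)
Lemma lipschitz_convex_subgradient (R : realType) (X : normedModType R)
    (g : X -> R) (v : X) :
  convex_on_lmod g -> (forall u w, `|g u - g w| <= `|u - w|) ->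
  exists2 f : X -> R, bounded_functional f & forall h, g v + f h <= g (v + h).
Proof.
move=> cg lg; pose p h := g (v + h) - g v.
have cp : convex_on_lmod p.
  move=> t u w t01; have := cg _ (v + u) (v + w) t01.
  rewrite !scalerDr addrACA -scalerDl (addrC t) subrK scale1r /p; lra.
have [|f flin fp] := linear_minorant cp; first by rewrite /p addr0 subrr.
exists f; last by move=> h; have := fp h; rewrite /p; lra.
have f0 : f 0 = 0.
  by have := flin 1 0 0; rewrite scale1r addr0 mul1r => /eqP; lra.
have fN h : f (- h) = - f h.
  by have := flin (-1) h 0; rewrite scaleN1r addr0 f0 addr0 mulN1r.
have fle h : f h <= `|h|.
  apply: le_trans (fp h) _; apply: le_trans (ler_norm _) _.
  by apply: le_trans (lg _ _) _; rewrite addrC addKr.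
split=> // u; apply/cvgrPdist_lt => e e0; near=> w.
have ut : `|u - w| < e by near: w; exact: cvgr_dist_lt.
have -> : f u - f w = f (u - w).
  by have := flin 1 u (- w); rewrite scale1r mul1r fN.
apply: le_lt_trans ut; rewrite ler_norml fle andbT lerNl -fN.
by rewrite -normrN.
Unshelve. all: by end_near. Qed.

(** * Limits and iterated limits along an ultrafilter *)

Lemma ultra_bounded_cvg (R : realType) (T : Type) (U : set_system T)
    (u : T -> R) (M : R) :
  UltraFilter U -> (forall n, `|u n| <= M) -> cvg (u @ U).
Proof.
move=> UU uM; have uU : (u @ U) [set` `[- M, M]].
  by apply: (@filterE _ U) => n; rewrite /= in_itv/= -ler_norml.
have [l [_ ul]] := @segment_compact R (- M) M (u @ U) _ uU.
apply/cvg_ex; exists l => B Bl.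
(* The cluster point given by compactness is a limit: otherwise the complement of one of its
   neighbourhoods would belong to the ultrafilter. *)
have [//|UB] := in_ultra_setVsetC (u @^-1` B) UU.
by have [r []] := ul (~` B) B UB Bl.
Qed.

Lemma near_seq (T : Type) (V : eqType) (F : set_system T) (P : V -> T -> Prop)
    (s : seq V) :
  Filter F -> (forall v, \forall x \near F, P v x) ->
  \forall x \near F, forall v, v \in s -> P v x.
Proof.
move=> FF FP; elim: s => [|v s IH]; first exact: filterE.
near=> x => w; rewrite inE => /predU1P[->|].
  by near: x; exact: FP.
by move: w; near: x.
Unshelve. all: by end_near. Qed.

Section iterated_limit.
Variables (R : realType) (X : normedModType R) (A : finType).
Variables (y : A -> nat -> X) (U : set_system nat).
Hypothesis y1 : forall a j, `|y a j| = 1.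
Hypothesis y0 : forall a, weakly_null (y a).
Hypothesis UU : UltraFilter U.
Hypothesis Uoo : \oo `<=` U.

(** The head letter is the outermost limit. An ultrafilter makes the limits exist for all [v] at
    once, without passing to subsequences. *)
Fixpoint iterated_limit (w : seq A) (v : X) : R :=
  if w is a :: w' then lim ((fun j => iterated_limit w' (v + y a j)) @ U)
  else `|v|.

(** The Lipschitz bound is a hypothesis because the two facts alternate in an induction: the bound
    for [w] gives convergence for [a :: w], and the limit inherits the bound. *)
Lemma iterated_limit_cvg_of_lipschitz w v a :
  (forall u u', `|iterated_limit w u - iterated_limit w u'| <= `|u - u'|) ->
  (fun j => iterated_limit w (v + y a j)) @ U --> iterated_limit (a :: w) v.
Proof.
move=> lip.
apply: (@ultra_bounded_cvg _ _ _ _ (`|iterated_limit w v| + 1)) => //.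
move=> j; rewrite -lerBlDl; apply: le_trans (lerB_dist _ _) _.
by apply: le_trans (lip _ _) _; rewrite addrC addKr y1.
Qed.

Lemma iterated_limit_lipschitz w u v :
  `|iterated_limit w u - iterated_limit w v| <= `|u - v|.
Proof.
elim: w u v => [|a w IH] u v; first exact: ler_dist_dist.
have cu := @iterated_limit_cvg_of_lipschitz w u a IH.
have cv := @iterated_limit_cvg_of_lipschitz w v a IH.
apply: (ler_cvg_to (cvg_norm (cvgB cu cv)) (cvg_cst `|u - v|)).
apply: nearW => j; apply: le_trans (IH _ _) _.
by rewrite opprD addrACA subrr addr0.
Qed.

Lemma iterated_limit_cvg w v a :
  (fun j => iterated_limit w (v + y a j)) @ U --> iterated_limit (a :: w) v.
Proof.
by apply: iterated_limit_cvg_of_lipschitz => *; exact: iterated_limit_lipschitz.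
Qed.

Lemma convex_iterated_limit w : convex_on_lmod (iterated_limit w).
Proof.
elim: w => [|a w IH] t u v t01 /=.
  case/andP: t01 => t0 t1; apply: le_trans (ler_normD _ _) _.
  by rewrite !normrZ (ger0_norm t0) ger0_norm// subr_ge0.
have cu := @iterated_limit_cvg w u a.
have cv := @iterated_limit_cvg w v a.
apply: (ler_cvg_to (@iterated_limit_cvg w _ a)
  (cvgD (cvgM (cvg_cst t) cu) (cvgM (cvg_cst (1 - t)) cv))).
apply: nearW => j; apply: le_trans (IH _ _ _ t01).
by rewrite !scalerDr addrACA -scalerDl (addrC t) subrK scale1r.
Qed.

(** A subgradient [f] at [v] bounds the terms of the limit below by
    [iterated_limit w v + f (y a j)], and [f (y a j)] tends to [0]. *)
Lemma iterated_limit_cons_ge w a v :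
  iterated_limit w v <= iterated_limit (a :: w) v.
Proof.
have [f fb fP] := lipschitz_convex_subgradient v (@convex_iterated_limit w)
  (@iterated_limit_lipschitz w).
have fy : f (y a j) @[j --> U] --> 0.
  by apply: (cvg_trans _ (@y0 a f fb)) => B; exact: Uoo.
rewrite -[leLHS]addr0.
apply: (ler_cvg_to (cvgD (cvg_cst _) fy) (@iterated_limit_cvg w v a)).
by apply: nearW => j; exact: fP.
Qed.

Lemma iterated_limit_filter (p : pred A) w v :
  iterated_limit [seq a <- w | p a] v <= iterated_limit w v.
Proof.
elim: w v => [|a w IH] v //=; case: (p a) => /=; last first.
  exact: le_trans (IH _) (iterated_limit_cons_ge _ _ _).
apply: (ler_cvg_to (@iterated_limit_cvg _ v a) (@iterated_limit_cvg _ v a)).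
by apply: nearW => j; exact: IH.
Qed.
End iterated_limit.

(** * Choice of columns on which norms approximate iterated limits *)

Section selection.
Variables (R : realType) (X : normedModType R) (A : finType).
Variables (y : A -> nat -> X) (U : set_system nat).
Hypothesis y1 : forall a j, `|y a j| = 1.
Hypothesis UU : UltraFilter U.
Hypothesis Uoo : \oo `<=` U.
Local Notation L := (iterated_limit y U).

(** Bounding the length of [w] leaves finitely many conditions on [j], so they hold together along
    the ultrafilter. *)
Definition good_column (d : R) (S : seq X) (N j : nat) :=
  (N < j)%N /\ forall v, v \in S -> forall a (w : #|A|.-bseq A),
    `|L w (v + y a j) - L (a :: w) v| <= d.

Lemma exists_good_column d S N : 0 < d -> exists j, good_column d S N j.
Proof.
move=> d0; suff : \forall j \near U, good_column d S N j.
  by move=> /filter_ex [j Pj]; exists j.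
have UN : \forall j \near U, (N < j)%N by apply: Uoo; exact: nbhs_infty_gt.
have US : \forall j \near U, forall v, v \in S ->
    forall a (w : #|A|.-bseq A), `|L w (v + y a j) - L (a :: w) v| <= d.
  apply: near_seq => v; apply: filter_forall => a; apply: filter_forall => w.
  have cv : (fun j => L w (v + y a j)) @ U --> L (a :: w) v.
    exact: iterated_limit_cvg.
  by move/cvgrPdistC_le : cv => /(_ d d0).
by near=> j; split; [near: j|near: j].
Unshelve. all: by end_near. Qed.

Lemma exists_columns (d : R) (N : nat) : 0 < d ->
  exists (c : nat -> nat) (S : nat -> seq X),
    [/\ (N <= c 0)%N, {homo c : m n / (m < n)%N}, 0 \in S 0%N,
       forall n v, v \in S n -> v \in S n.+1 &
       forall n v a, v \in S n -> v + y a (c n) \in S n.+1 /\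
         forall w : #|A|.-bseq A,
           `|L w (v + y a (c n)) - L (a :: w) v| <= d].
Proof.
move=> d0; have /choice [g gP] :
    forall SN : seq X * nat, exists j, good_column d SN.1 SN.2 j.
  by move=> [S M]; exact: exists_good_column.
(* A state lists the sums reachable with the columns chosen so far, and the last column. State [0]
   carries [N] instead, so column [n] is stored in state [n.+1]. *)
pose step (SN : seq X * nat) : seq X * nat :=
  (SN.1 ++ [seq v + y a (g SN) | v <- SN.1, a <- enum A], g SN).
pose st n := iter n step ([:: 0], N).
have stc n : good_column d (st n).1 (st n).2 (st n.+1).2 by exact: gP.
exists (fun n => (st n.+1).2), (fun n => (st n).1); split => //.
- by have [/ltnW] := stc 0%N.
- by apply: homo_ltn => [|n]; [exact: ltn_trans | have [] := stc n.+1].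
- by rewrite inE.
- by move=> n v vS; rewrite /= mem_cat vS.
- move=> n v a vS; split; last by have [_ /(_ v vS a)] := stc n.
  rewrite /= mem_cat; apply/orP; right; apply/allpairsP; exists (v, a).
  by rewrite /= mem_enum.
Qed.

(** Induction on [w]: placing the head letter in its column costs [d], and the new sum lies in
    [S (pos a).+1], ready for the next, larger position. *)
Lemma columns_iterated_limit (d : R) (c : nat -> nat) (S : nat -> seq X)
    (pos : A -> nat) (w : seq A) (n : nat) (v : X) :
  (forall n v, v \in S n -> v \in S n.+1) ->
  (forall n v a, v \in S n -> v + y a (c n) \in S n.+1 /\
     forall w : #|A|.-bseq A, `|L w (v + y a (c n)) - L (a :: w) v| <= d) ->
  (size w <= #|A|)%N -> sorted ltn [seq pos a | a <- w] ->
  all (leq n) [seq pos a | a <- w] -> v \in S n ->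
  `| `|v + \sum_(a <- w) y a (c (pos a))| - L w v| <= d *+ size w.
Proof.
move=> Ss Sc; have Smono m p u : (m <= p)%N -> u \in S m -> u \in S p.
  by move/subnK <-; elim: (p - m)%N => // i IH /IH; exact: Ss.
elim: w n v => [|a w IH] n v.
  by rewrite big_nil addr0 subrr normr0 mulr0n.
rewrite /= big_cons => sw /[dup] pw /path_sorted sow /andP[na _] vS.
have [vaS Lva] := Sc _ _ a (Smono _ _ _ na vS).
have := IH (pos a).+1 _ (ltnW sw) sow (order_path_min ltn_trans pw) vaS.
rewrite addrA => IHw; have {}Lva := Lva (Bseq (ltnW sw)).
rewrite mulrSr; apply: le_trans (lerD IHw Lva).
by apply: le_trans (ler_normD _ _); rewrite addrA subrK.
Qed.

End selection.

(** With the letters of [P] sorted by column, both sums are within [d / 2] of iterated limits, one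
    over a word and one over a subword; erasing letters does not increase these. *)
Lemma weakly_null_suppression_unconditional (R : realType)
    (X : normedModType R) (A : finType) (y : A -> nat -> X) (d : R) (N : nat) :
  (forall a j, `|y a j| = 1) -> (forall a, weakly_null (y a)) -> 0 < d ->
  exists c : nat -> nat,
    [/\ (N <= c 0)%N, {homo c : m n / (m < n)%N} &
      forall (P Q : pred A) (pos : A -> nat), {in P &, injective pos} ->
        `|\sum_(a | P a && Q a) y a (c (pos a))| <=
        `|\sum_(a | P a) y a (c (pos a))| + d].
Proof.
move=> y1 y0 d0.
have [U [UU Uoo]] := ultraFilterLemma (eventually_filter).
(* At most [#|A|] letters then cost at most [d / 2] in total; the successor avoids dividing by
   [0]. *)
pose d' := d / 2 / #|A|.+1%:R.
have d'0 : 0 < d' by rewrite !divr_gt0.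
have [c [S [cN cm S0 Ss Sc]]] := exists_columns y1 UU Uoo N d'0.
exists c; split=> // P Q pos posI.
pose w := sort (relpre pos leq) (enum P).
have sw : sorted ltn [seq pos a | a <- w].
  rewrite ltn_sorted_uniq_leq sorted_map sort_sorted ?andbT/=; last first.
    by move=> a b; exact: leq_total.
  rewrite map_inj_in_uniq ?sort_uniq ?enum_uniq//.
  by move=> a b; rewrite !mem_sort !mem_enum; exact: posI.
have approx (p : pred A) :
    `| `|\sum_(a <- [seq a <- w | p a]) y a (c (pos a))| -
       iterated_limit y U [seq a <- w | p a] 0| <= d / 2.
  have szw : (size [seq a <- w | p a] <= #|A|)%N.
    rewrite size_filter (leq_trans (count_size _ _))//.
    by rewrite size_sort -cardE max_card.
  have := columns_iterated_limit (pos := pos) Ss Sc szw _ _ S0.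
  rewrite add0r => /(_ _ _)/le_trans; apply.
  - move: sw; rewrite !sorted_map; apply: sorted_filter.
    by move=> a b e; exact: ltn_trans.
  - exact/allP.
  - rewrite -[leRHS](divfK (lt0r_neq0 (ltr0Sn R #|A|))) mulr_natr.
    by apply: ler_wpMn2l; [exact: ltW | exact: ltnW].
have sumw (p : pred A) : \sum_(a <- [seq a <- w | p a]) y a (c (pos a)) =
    \sum_(a | P a && p a) y a (c (pos a)).
  rewrite big_filter (perm_big (enum P)) ?perm_sort//= big_enum_cond.
  by [].
have := approx Q; have := approx predT; rewrite !sumw.
under [in X in X -> _]eq_bigl do rewrite andbT.
rewrite filter_predT.
have := iterated_limit_filter y1 y0 UU Uoo Q w 0.
rewrite !ler_norml => H /andP[H1 H2] /andP[H3 H4]; lra.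
Qed.

(** * The embedding and its distortion *)

Lemma weakly_nullN (R : realType) (X : normedModType R) (u : nat -> X) :
  weakly_null u -> weakly_null (fun j => - u j).
Proof.
move=> u0 f fb; have [flin _] := fb.
have f0 : f 0 = 0.
  by have := flin 1 0 0; rewrite scale1r addr0 mul1r => /eqP; lra.
have -> : f \o (fun j => - u j) = - (f \o u).
  apply/funext => j /=; have := flin (-1) (u j) 0.
  by rewrite scaleN1r !addr0 f0 addr0 mulN1r.
by rewrite -oppr0; apply: cvgN; exact: u0.
Qed.

(** The model estimate is used at a length [N >= k] whose error is below [d], with coefficients [0]
    or [1] that vanish from [k] on. *)
Lemma asymptotic_model_sum (R : realType) (X E : normedModType R)
    (x : nat -> nat -> X) (e : nat -> E) (k : nat) (d : R) :
  asymptotic_model x e -> 0 < d ->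
  exists N, forall (F : pred nat) (kk : nat -> nat), (N <= kk 0)%N ->
    {homo kk : i j / (i < j)%N} ->
    `| `|\sum_(i < k | F i) x i (kk i)| - `|\sum_(i < k | F i) e i| | < d.
Proof.
move=> [_ [et [et01 [et0 am]]]] d0.
have [N [kN etN]] : exists N, (k <= N)%N /\ et N < d.
  have /filter_ex [N [? ?]] : \forall N \near \oo, (k <= N)%N /\ et N < d.
    near=> N; split; first by near: N; exact: nbhs_infty_ge.
    by near: N; apply: (cvgr_lt 0).
  by exists N.
exists N => F kk Nkk kkm; apply: lt_trans etN.
have := am N (fun i => ((i < k)%N && F i)%:R) kk _ Nkk
  (fun i _ => kkm _ _ (ltnSn i)).
have sumE (V : normedModType R) (z : nat -> V) :
    \sum_(i < N) ((i < k)%N && F i)%:R *: z i = \sum_(i < k | F i) z i.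
  rewrite (big_ord_widen_cond N (fun i => F i) z kN) [RHS]big_mkcond/=.
  by apply: eq_bigr => i _; rewrite andbC; case: ifP; rewrite ?scale1r ?scale0r.
rewrite (sumE _ (fun i => x i (kk i))) sumE; apply.
by move=> i _; rewrite lern1 leq_b1 andbT (le_trans (lerN10 R)) ?ler0n.
Unshelve. all: by end_near. Qed.

(** Capping the index at [k.-1] repeats the last entry beyond the tuple, and the summand [i] keeps
    the sequence strictly increasing on all of [nat]. *)
Lemma interleave_homo (m : seq nat) (k : nat) :
  size m = k -> (0 < k)%N -> sorted ltn m ->
  {homo (fun i => nth 0%N m (minn i k.-1) * k + i)%N : i j / (i < j)%N}.
Proof.
move=> mk k0 sm i j ij; rewrite -addnS leq_add// leq_mul2r; apply/orP; right.
have lem : sorted leq m by apply: sub_sorted sm => a b; exact: ltnW.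
apply: (sorted_leq_nth leq_trans leqnn 0%N lem); rewrite ?inE ?mk.
- by rewrite gtn_min ltn_predL k0 orbT.
- by rewrite gtn_min ltn_predL k0 orbT.
- by rewrite leq_min geq_minr andbT geq_min (ltnW ij).
Qed.

Theorem theorem3p9 (R : realType) (X : completeNormedModType R)
  (E : completeNormedModType R) (x : nat -> nat -> X) (e : nat -> E) :
  normalized_weakly_null_array x ->
  asymptotic_model x e ->
  forall (k : nat) (eps : R), 0 < eps ->
    bilip_embeds (@dk R E e k) X (2 + eps).
Proof.
move=> [x1 x0] am k eps eps0.
(* Chosen so that [(1 - 6 * d) * (2 + eps) = 2 + 4 * d]. The additive errors [2 * d] in both bounds
   are then absorbed once [dk e m n >= 1 / 2]. *)
pose d := eps / (16 + 6 * eps).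
have D0 : 0 < 16 + 6 * eps by lra.
have d0 : 0 < d by rewrite divr_gt0.
have dE : d * (16 + 6 * eps) = eps by rewrite divfK ?gt_eqF.
have d6 : 6 * d < 1.
  by rewrite mulrA ltr_pdivrMr//; lra.
have [N amN] := asymptotic_model_sum k am d0.
(* Letters are signed rows, so that [g m - g n] becomes one sum of letters: [false] marks the part
   of [m], [true] that of [n]. *)
pose y (p : 'I_k * bool) j := if p.2 then - x p.1 j else x p.1 j.
have y1 p j : `|y p j| = 1 by rewrite /y; case: p.2; rewrite ?normrN x1.
have y0 p : weakly_null (y p).
  by rewrite /y; case: p.2 => //; exact: weakly_nullN.
have [c [cN cm unc]] := weakly_null_suppression_unconditional N y1 y0 d0.
pose col (m : kset k) i := c (nth 0%N (val m) i * k + i)%N.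
pose g (m : kset k) := \sum_(i < k) x i (col m i).
exists (1 - 6 * d); split; first lra.
exists g => m n.
pose F i := nth 0%N (val m) i != nth 0%N (val n) i.
have dkE : dk e m n = `|\sum_(i < k | F i) e i|.
  by congr `|_|; apply: eq_bigl => i; rewrite !(tnth_nth 0%N).
have gE : g m - g n =
    \sum_(i < k | F i) x i (col m i) - \sum_(i < k | F i) x i (col n i).
  rewrite -!sumrB [RHS]big_mkcond/=; apply: eq_bigr => i _.
  by rewrite /F; case: eqP => //= mn; rewrite /col mn subrr.
have [/existsP[j Fj]|/existsPn noF] := boolP [exists j : 'I_k, F j]; last first.
  have F0 (i : 'I_k) : F i = false by exact/negbTE.
  by rewrite dkE gE !big_pred0// subrr !normr0 !mulr0 lexx.
have k0 : (0 < k)%N by exact: leq_ltn_trans (ltn_ord j).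
have approx (z : kset k) :
    `| `|\sum_(i < k | F i) x i (col z i)| - dk e m n | < d.
  pose kk i := c (nth 0%N (val z) (minn i k.-1) * k + i)%N.
  have := amN F kk.
  rewrite dkE (_ : \sum_(i < k | F i) x i (kk i) =
    \sum_(i < k | F i) x i (col z i)); last first.
    apply: eq_bigr => i _; rewrite /kk (minn_idPl _)//.
    by rewrite -ltnS prednK.
  apply.
    have c0 i : (c 0 <= c i)%N by case: i => // i; apply/ltnW/cm.
    exact: leq_trans cN (c0 _).
  move=> i i' ii'; apply: cm; apply: interleave_homo ii' => //.
    by rewrite size_tuple.
  exact: svalP z.
pose pos (p : 'I_k * bool) :=
  (nth 0%N (val (if p.2 then n else m)) p.1 * k + p.1)%N.
(* The residue modulo [k] recovers the row; within a row, [F] says that [m] and [n] use different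
   columns. *)
have posI : {in [pred p | F (val p.1)] &, injective pos}.
  move=> [i b] [i' b']; rewrite !inE/= => Fi Fi' pp.
  have ii' : i = i'.
    apply/val_inj; have := congr1 (modn^~ k) pp.
    by rewrite /pos /= !modnMDl !modn_small.
  subst i'; congr (_, _); move: pp => /addIn/eqP.
  rewrite eqn_pmul2r// /=; move: Fi; rewrite /F.
  by move=> /negP mn; case: b b' => [] [] //= /eqP nm; case: mn; rewrite nm.
have sum_m : \sum_(p | F (val p.1) && ~~ p.2) y p (c (pos p)) =
    \sum_(i < k | F i) x i (col m i).
  rewrite -(pair_big (fun i : 'I_k => F i) (fun b : bool => ~~ b)
    (fun i b => y (i, b) (c (pos (i, b))))) /=.
  by apply: eq_bigr => i _; rewrite (big_pred1 false)//; case.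
have sum_mn : \sum_(p | F (val p.1)) y p (c (pos p)) = g m - g n.
  rewrite gE -sumrB.
  under eq_bigl do rewrite -[F _]andbT.
  rewrite -(pair_big (fun i : 'I_k => F i) (fun b : bool => true)
    (fun i b => y (i, b) (c (pos (i, b))))) /=.
  by apply: eq_bigr => i _; rewrite big_bool addrC.
have lower := unc [pred p | F (val p.1)] (fun p => ~~ p.2) pos posI.
rewrite sum_m sum_mn in lower.
(* Erasing all letters but one leaves a unit vector, which keeps [dk e m n] away from [0]. *)
have large : 1 <= `|\sum_(i < k | F i) x i (col m i)| + d.
  have := unc [pred p | F (val p.1) && ~~ p.2] (pred1 (j, false)) pos.
  rewrite sum_m (big_pred1 (j, false)) ?y1; last first.
    by move=> p /=; rewrite andb_idl// => /eqP ->/=; rewrite Fj.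
  apply; move=> p q /andP[Fp _] /andP[Fq _]; exact: posI.
have upper := ler_normB (\sum_(i < k | F i) x i (col m i))
  (\sum_(i < k | F i) x i (col n i)).
rewrite -gE in upper.
have := approx m; have := approx n.
rewrite !ltr_norml => /andP[An1 An2] /andP[Am1 Am2].
have d23 : 1 - 2 * d <= dk e m n by lra.
apply/andP; split; nra.
Qed.
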